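(* Let $p\in(0,1)$ and let $\hat{\mathbf{y}}^t=\mathrm{col}(\hat y_0^t,\dots,\hat y_{L'-1}^t)$, $\hat y_k^t\in\mathbb{R}^{n_y}$, be the random output prediction with mean $\bar{\mathbf{y}}^t$ and covariance $\Sigma^t$. For $k=0,\dots,L'-1$ let $\mathcal{Y}_{t+k}=\{y\in\mathbb{R}^{n_y} : H^{t+k}y\le q^{t+k}\}$ with $H^{t+k}=[h_1^{t+k}\ \cdots\ h_{n_c}^{t+k}]^\top\in\mathbb{R}^{n_c\times n_y}$ and $q^{t+k}=\mathrm{col}(q_1^{t+k},\dots,q_{n_c}^{t+k})\in\mathbb{R}^{n_c}$, and define $$\bar H^t:=\mathrm{blkdiag}(H^t,\dots,H^{t+L'-1}),\qquad \bar q^t:=\mathrm{col}(q^t,\dots,q^{t+L'-1}).$$ Consider the constraint $$\bar q^t-\bar H^t\bar{\mathbf{y}}^t\ \ge\ \mu\sqrt{\mathrm{diag}\left(\bar H^t\Sigma^t(\bar H^t)^\top\right)}.\qquad(\ast)$$ (i) If $\mu\ge\sqrt{\frac{1}{1-p}-1}$, then $(\ast)$ guarantees the element-wise chance constraints $$\Pr\left((h_i^{t+k})^\top\hat y_k^t\le q_i^{t+k}\right)\ge p,\qquad \forall\, i=1,\dots,n_c,\ k=0,\dots,L'-1.$$ (ii) If $\mu\ge\sqrt{\frac{n_y}{1-p}}$, then $(\ast)$ guarantees the set-wise chance constraints $$\Pr\left(\hat y_k^t\in\mathcal{Y}_{t+k}\right)\ge p,\qquad \forall\, k=0,\dots,L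'-1.$$
   Context: Vector inequalities and the square root of a vector are element-wise; $\mathrm{diag}(\cdot)$ of a square matrix is the vector of its diagonal elements; $\mathrm{col}$ denotes vertical stacking and $\mathrm{blkdiag}$ block-diagonal concatenation. $\hat{\mathbf{y}}^t$ is an $\mathbb{R}^{n_yL'}$-valued random vector of which only the first two moments, $\mathbb{E}[\hat{\mathbf{y}}^t]=\bar{\mathbf{y}}^t$ and $\mathrm{cov}(\hat{\mathbf{y}}^t)=\Sigma^t$, are specified; no assumption on the shape of the distribution is made. In the application, these moments (conditional on the vector $g^t\in\mathbb{R}^M$) come from a stochastic data-driven predictor: $\bar{\mathbf{y}}^t=Y_fg^t-\Gamma(Y_pg^t-\bar{\mathbf{y}}_{\rm ini}^t)$ and $\Sigma^t=\Gamma P_t\Gamma^\top+\Gamma_w\Sigma_w\Gamma_w^\top+\|g^t\|_2^2\,\sigma^2(\Gamma\Gamma^\top+\mathbb{I}_{n_yL'})$, where $Y_p,Y_f$ are output data matrices, $\Gamma,\Gamma_w$ are fixed matrices, $P_t,\Sigma_w$ are covariance matrices of the past output sequence and of the disturbance sequence, $\bar{\mathbf{y}}_{\rm ini}^t$ is the mean of the past output sequence, and $\sigma^2$ is the output noise variance. Probabilities are with respect to the distribution of $\hat{\mathbf{y}}^t$. *)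

(* Defs.v *)
From mathcomp Require Import all_boot all_order all_algebra.
From mathcomp Require Import all_classical all_reals all_analysis.

Set Implicit Arguments.
Unset Strict Implicit.
Unset Printing Implicit Defensive.

Import Order.TTheory GRing.Theory Num.Theory.
Local Open Scope classical_set_scope.
Local Open Scope ring_scope.

Section Vectors.
Context {R : realType}.

Definition vle n (u v : 'cV[R]_n) : Prop := forall i, u i 0 <= v i 0.

Definition vsqrt n (u : 'cV[R]_n) : 'cV[R]_n := map_mx Num.sqrt u.

Definition diagv n (A : 'M[R]_n) : 'cV[R]_n := \col_i A i i.

(* [\mxdiag] only allows square blocks. *)
Definition blkdiag L m n (B : 'I_L -> 'M[R]_(m, n)) :
    'M[R]_(\sum_(k < L) m, \sum_(k < L) n) :=
  \mxblock_(j < L, k < L) (if j == k then B j else 0).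

Definition polyhedron m n (H : 'M[R]_(m, n)) (q : 'cV[R]_m) : set 'cV[R]_n :=
  [set y | vle (H *m y) q].

End Vectors.

Section RandomVectors.
Context {d : measure_display} {T : measurableType d} {R : realType}.

Definition component n (Y : T -> 'cV[R]_n) (i : 'I_n) : T -> R :=
  fun w => Y w i 0.

(* Membership in [Lfun P 2] makes each component measurable, so that [Y] is a
   random vector, and square-integrable, so that both moments exist; without
   integrability, ['E_P[_]] may return a default value. *)
Definition has_mean_cov (P : probability T R) n (Y : T -> 'cV[R]_n)
    (m : 'cV[R]_n) (S : 'M[R]_n) : Prop :=
  [/\ forall i, component Y i \in Lfun P 2%:E,
      forall i, ('E_P[component Y i] = (m i 0)%:E)%E &
      forall i j, covariance P (component Y i) (component Y j) = (S i j)%:E].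

End RandomVectors.

(* Main.v *)
Require Import Defs.
From HB Require Import structures.
From mathcomp Require Import all_boot all_order all_algebra.
From mathcomp Require Import ring lra.
From mathcomp Require Import all_classical all_reals all_analysis.
From mathcomp Require Import measurable_realfun.

Set Implicit Arguments.
Unset Strict Implicit.
Unset Printing Implicit Defensive.

Import Order.TTheory GRing.Theory Num.Theory.
Local Open Scope classical_set_scope.
Local Open Scope ring_scope.

(* Each step output [y k] is a linear image of the stacked vector, so its mean
   and covariance [S] are the corresponding blocks.  (i) is Cantelli's
   one-sided inequality.  For (ii), factor [S = B B^T] with [A B = 1]: almost
   surely [y k - ybar = B z], where [z = A (y k - ybar)] has identity covariance
   of dimension [rank S <= ny], so [P (|z|^2 >= mu^2) <= ny / mu^2 <= 1 - p] by
   Markov; whenever [|z| < mu], Cauchy-Schwarz gives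
   [h^T (y k - ybar) <= |B^T h| |z| <= mu sqrt (h^T S h)] for all rows [h] at
   once.  The factorization avoids assuming [S] invertible. *)

(** * Linear algebra: Cauchy-Schwarz and factorization of semidefinite matrices *)

Lemma affine_ge0_slope0 (R : realFieldType) (b c : R) :
  (forall x, 0 <= x * b + c) -> b = 0.
Proof.
move=> h; apply/eqP; apply: contraT => b0.
(* At this point the affine function takes the value -1. *)
have := h (- (c + 1) / b); rewrite mulfVK // => {}h.
by exfalso; lra.
Qed.

(** Cauchy-Schwarz, from the nonnegativity of [|s u + t v^T|^2] for all [s] and [t]. *)
Lemma dot_le_norm (R : rcfType) n (u : 'rV[R]_n) (v : 'cV[R]_n) :
  (u *m v) 0 0 <= Num.sqrt ((u *m u^T) 0 0) * Num.sqrt ((v^T *m v) 0 0).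
Proof.
set a := (u *m u^T) 0 0; set b := (u *m v) 0 0; set c := (v^T *m v) 0 0.
have sq_ge0 k (w : 'rV[R]_k) : 0 <= (w *m w^T) 0 0.
  by rewrite mxE sumr_ge0 // => i _; rewrite mxE -expr2 sqr_ge0.
have quad s t : 0 <= s ^+ 2 * a + 2 * s * t * b + t ^+ 2 * c.
  have := sq_ge0 _ (s *: u + t *: v^T).
  rewrite linearD !linearZ /= trmxK mulmxDl !mulmxDr -!scalemxAl -!scalemxAr.
  rewrite -trmx_mul /a /b /c; move: (u *m u^T) (u *m v) (v^T *m v) => A B C.
  rewrite !mxE => h.
  by apply: le_trans h _; rewrite le_eqVlt; apply/orP; left; apply/eqP; ring.
have a0 : 0 <= a by exact: sq_ge0.
have c0 : 0 <= c by have := sq_ge0 _ v^T; rewrite trmxK.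
rewrite -sqrtrM // (le_trans (ler_norm b)) // -sqrtr_sqr ler_wsqrtr //.
have [a_eq0|a_neq0] := eqVneq a 0.
  suff -> : b = 0 by rewrite expr0n mulr_ge0.
  (* With [a = 0], the form at [(x / 2, 1)] is [x * b + c]. *)
  apply: (@affine_ge0_slope0 _ _ c) => x.
  have := quad (x / 2) 1; rewrite a_eq0; nra.
have a_gt0 : 0 < a by rewrite lt_def a_neq0.
(* At [s = - b], [t = a] the form is [a] times [a * c - b ^+ 2]. *)
have := quad (- b) a.
have -> : (- b) ^+ 2 * a + 2 * - b * a * b + a ^+ 2 * c = a * (a * c - b ^+ 2).
  by ring.
by rewrite pmulr_rge0 // subr_ge0.
Qed.

(* A Cholesky factorization that drops the columns of the zero pivots. *)
Lemma psd_rank_factorization (R : rcfType) n (S : 'M[R]_n) :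
  S^T = S -> (forall x : 'rV[R]_n, 0 <= (x *m S *m x^T) 0 0) ->
  exists r (B : 'M[R]_(n, r)) (A : 'M[R]_(r, n)), S = B *m B^T /\ A *m B = 1%:M.
Proof.
elim: n S => [|n IHn] S symS psdS.
  by exists 0%N, 0, 0; split; apply/matrixP => -[].
move: S symS psdS; rewrite -[n.+1]/(1 + n)%N => S symS psdS.
pose a := ulsubmx S 0 0; pose b := ursubmx S; pose D := drsubmx S.
have SE : S = block_mx a%:M b b^T D.
  by rewrite /a -mx11_scalar /b trmx_ursub symS submxK.
have symD : D^T = D by rewrite /D trmx_drsub symS.
(* The form of [S] is read as a quadratic polynomial in the first coordinate [s]. *)
have quad s (x : 'rV_n) : (row_mx s%:M x *m S *m (row_mx s%:M x)^T) 0 0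
    = s ^+ 2 * a + 2 * s * (x *m b^T) 0 0 + (x *m D *m x^T) 0 0.
  rewrite SE mul_row_block tr_row_mx mul_row_col tr_scalar_mx.
  rewrite !mulmxDl !mul_scalar_mx -!scalemxAl !mul_mx_scalar.
  have -> : b *m x^T = (x *m b^T)^T by rewrite trmx_mul trmxK.
  move: (x *m b^T) (x *m D *m x^T) => y z.
  by rewrite !mxE /= mulr1n; ring.
have a_ge0 : 0 <= a.
  by have := psdS (row_mx 1%:M 0); rewrite quad !mul0mx !mxE; lra.
have [a_eq0|a_neq0] := eqVneq a 0.
  have b_eq0 : b = 0.
    apply/rowP => j; rewrite [RHS]mxE.
    (* Zero pivot: along the [j]-th basis vector the form is affine in [s] with slope [b 0 j], so
       semidefiniteness clears the whole row. *)
    apply: (@affine_ge0_slope0 _ _ (D j j)) => s.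
    have := psdS (row_mx (s / 2)%:M (delta_mx 0 j)); rewrite quad a_eq0.
    rewrite -rowE -[X in _ + (X *m _) 0 0]rowE.
    have -> : (delta_mx 0 j)^T = delta_mx j 0 :> 'cV[R]_n.
      by rewrite trmx_delta.
    rewrite -colE !mxE; nra.
  have [x|r [B [A [DE AB]]]] := IHn D symD.
    by have := psdS (row_mx 0%:M x); rewrite quad expr0n mulr0 !mul0r !add0r.
  exists r, (col_mx 0 B), (row_mx 0 A); split.
    rewrite tr_col_mx mul_col_row SE a_eq0 b_eq0 DE !trmx0 !mulmx0 !mul0mx.
    by rewrite raddf0.
  by rewrite mul_row_col mul0mx add0r.
have a_gt0 : 0 < a by rewrite lt_def a_neq0.
pose s := Num.sqrt a.
have s_neq0 : s != 0 by rewrite gt_eqF // sqrtr_gt0.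
have ssE : s ^+ 2 = a by rewrite sqr_sqrtr.
(* Positive pivot: the induction continues on the Schur complement of [a]. *)
have [|x|r [B [A [DE AB]]]] := IHn (D - a^-1 *: (b^T *m b)).
- by rewrite linearB linearZ /= trmx_mul trmxK symD.
(* This first coordinate minimizes the form for fixed [x]; the minimum is the form of the Schur
   complement at [x]. *)
- have := psdS (row_mx (- (x *m b^T) 0 0 / a)%:M x); rewrite quad.
  rewrite mulmxBr mulmxBl -scalemxAr -scalemxAl mulmxA -(mulmxA (x *m b^T)).
  have -> : b *m x^T = (x *m b^T)^T by rewrite trmx_mul trmxK.
  move: (x *m b^T) => y h.
  rewrite [X in _ <= X](_ : _ = (x *m D *m x^T) 0 0 - a^-1 * (y 0 0) ^+ 2).
    apply: le_trans h _; rewrite le_eqVlt; apply/orP; left; apply/eqP.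
    by field.
  by rewrite !mxE big_ord1 !mxE expr2.
(* One Cholesky step. The lower-left block of the left inverse is chosen to cancel [s^-1 *: b^T]. *)
exists (1 + r)%N, (block_mx s%:M 0 (s^-1 *: b^T) B),
  (block_mx s^-1%:M 0 (- (a^-1 *: (A *m b^T))) A); split.
  rewrite SE tr_block_mx mulmx_block !trmx0 !mulmx0 !mul0mx !addr0 tr_scalar_mx.
  rewrite -scalar_mxM -expr2 ssE linearZ /= trmxK mul_mx_scalar mul_scalar_mx.
  rewrite !scalerA mulfV // !scale1r -DE -scalemxAl -scalemxAr scalerA.
  by rewrite -invfM -expr2 ssE addrC subrK.
rewrite mulmx_block !mulmx0 !mul0mx !addr0 add0r AB -scalar_mxM mulVf //.
rewrite mul_mx_scalar -scalemxAr scalerN scalerA -ssE.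
have -> : s * (s ^+ 2)^-1 = s^-1 by field.
by rewrite addNr -scalar_mx_block.
Qed.

(** * Moments of linear images of a random vector *)

Section Probability.
Context (d : measure_display) (T : measurableType d) (R : realType).
Variable P : probability T R.
Implicit Types X Y : T -> R.

Lemma Lfun2_Lfun1 X : X \in Lfun P 2%:E -> X \in Lfun P 1.
Proof. exact/Lfun_subset12/fin_num_measure. Qed.

Lemma Lfun2_measurable X : X \in Lfun P 2%:E -> measurable_fun setT X.
Proof. by move=> /sub_Lfun_mfun; rewrite inE. Qed.

Lemma Lfun2_sum (I : Type) (s : seq I) (X : I -> T -> R) :
  (forall i, X i \in Lfun P 2%:E) ->
  (fun w => \sum_(i <- s) X i w) \in Lfun P 2%:E.
Proof.
move=> X2; elim: s => [|i s IHs].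
  by under eq_fun do rewrite big_nil; exact: Lfun_cst.
by under eq_fun do rewrite big_cons; rewrite rpredD ?lee1n.
Qed.

Lemma expectation_suml (I : Type) (s : seq I) (X : I -> T -> R) :
  (forall i, X i \in Lfun P 2%:E) ->
  ('E_P[fun w => (\sum_(i <- s) X i w)%R] = \sum_(i <- s) 'E_P[X i])%E.
Proof.
move=> X2; elim: s => [|i s IHs].
  by under eq_fun do rewrite big_nil; rewrite big_nil expectation_cst.
under eq_fun do rewrite big_cons.
by rewrite big_cons -IHs -expectationD // Lfun2_Lfun1 // Lfun2_sum.
Qed.

Lemma covariance_suml (I : Type) (s : seq I) (X : I -> T -> R) Y :
  (forall i, X i \in Lfun P 2%:E) -> Y \in Lfun P 2%:E ->
  covariance P (fun w => \sum_(i <- s) X i w) Y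
  = (\sum_(i <- s) covariance P (X i) Y)%E.
Proof.
move=> X2 Y2; elim: s => [|i s IHs].
  by under eq_fun do rewrite big_nil; rewrite big_nil covariance_cst_l.
under eq_fun do rewrite big_cons.
by rewrite big_cons -IHs -covarianceDl // Lfun2_sum.
Qed.

(** Linearity of the mean and bilinearity of the covariance. It serves to extract a block, to
    project on a row and to whiten. *)
Lemma has_mean_cov_mulmx m n (A : 'M[R]_(m, n)) (Y : T -> 'cV[R]_n) mu S :
  has_mean_cov P Y mu S ->
  has_mean_cov P (fun w => A *m Y w) (A *m mu) (A *m S *m A^T).
Proof.
case=> Y2 EY covY.
pose Z i j := A i j \o* component Y j.
have Z2 i j : Z i j \in Lfun P 2%:E by rewrite Lfun_scale ?ler1n.
have ZE i : component (fun w => A *m Y w) i = fun w => \sum_j Z i j w.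
  apply/funext => w; rewrite /component mxE.
  by apply: eq_bigr => j _ /=; rewrite mulrC.
have covZ i j k l : covariance P (Z i j) (Z k l) = (A i j * S j l * A k l)%:E.
  have Y1 i' := Lfun2_Lfun1 (Y2 i'); have Z1 := Lfun2_Lfun1 (Z2 k l).
  have YZ1 := Lfun2_mul_Lfun1 (Y2 j) (Z2 k l).
  have YY1 := Lfun2_mul_Lfun1 (Y2 j) (Y2 l).
  rewrite [LHS]covarianceZl // covarianceZr // covY -!EFinM.
  by rewrite [A k l * _]mulrC mulrA.
split=> [i|i|i k]; rewrite !ZE ?Lfun2_sum //.
  rewrite expectation_suml // mxE -sumEFin; apply: eq_bigr => j _.
  by rewrite expectationZl ?Lfun2_Lfun1 // EY EFinM.
rewrite covariance_suml ?Lfun2_sum // mxE.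
(* [covariance_suml] expands the first argument, so the second is expanded between two swaps by
   symmetry. *)
under eq_bigr => j _.
  rewrite covarianceC covariance_suml ?Lfun2_sum //.
  under eq_bigr => l _ do rewrite covarianceC covZ.
  rewrite sumEFin; over.
rewrite sumEFin exchange_big /=; congr EFin; apply: eq_bigr => l _.
by rewrite !mxE mulr_suml.
Qed.

Lemma has_mean_cov_sym n (Y : T -> 'cV[R]_n) mu S :
  has_mean_cov P Y mu S -> S^T = S.
Proof.
case=> _ _ covY; apply/matrixP => i j; rewrite mxE; apply/EFin_inj.
by rewrite -!covY covarianceC.
Qed.

(** The form at [x] is the variance of the scalar [x *m Y w]. *)
Lemma has_mean_cov_psd n (Y : T -> 'cV[R]_n) mu S (x : 'rV[R]_n) :
  has_mean_cov P Y mu S -> 0 <= (x *m S *m x^T) 0 0.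
Proof.
move=> /(has_mean_cov_mulmx x)[_ _ covY].
by rewrite -lee_fin -covY variance_ge0.
Qed.

(** * Almost sure comparison and tail inequalities *)

Lemma le_probability_ae (A B : set T) : measurable A -> measurable B ->
  {ae P, forall w, A w -> B w} -> (P A <= P B)%E.
Proof.
move=> mA mB AB.
have AB0 : P (A `\` B) = 0%E.
  apply: measure_negligible; first exact: measurableD.
  by apply: negligibleS AB => w [Aw nBw] /(_ Aw).
have mAB : measurable (A `\` B) by exact: measurableD.
(* [A] lies in the union of [B] and the null set where the implication fails. *)
apply: (@le_trans _ _ (P (B `|` A `\` B))).
  apply: le_measure; rewrite ?inE //; first exact: measurableU.
  by move=> w Aw; have [Bw|nBw] := pselect (B w); [left|right].
by rewrite -[leRHS]adde0 -AB0; exact: measureU2.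
Qed.

(** The variance integrates a nonnegative square, so it vanishes only if that square is zero almost
    everywhere. *)
Lemma variance0_ae X : X \in Lfun P 2%:E -> 'V_P[X]%E = 0%E ->
  {ae P, forall w, X w = fine 'E_P[X]%E}.
Proof.
move=> X2; rewrite /variance covariance.unlock expectation.unlock => V0.
have mX := Lfun2_measurable X2.
have mS : measurable_fun setT (fun w => ((X w - fine 'E_P[X]%E) ^+ 2)%:E).
  by apply/measurable_EFinP; apply: measurable_funX; exact: measurable_funB.
have [ae0 _] := ae_eq_integral_abs P measurableT mS.
have : (\int[P]_w `|((X w - fine 'E_P[X]%E) ^+ 2)%:E| = 0)%E.
  rewrite -[RHS]V0; apply: eq_integral => w _ /=.
  by rewrite ger0_norm ?sqr_ge0 // expectation.unlock.
move=> /ae0; apply: filterS => w /= /(_ I) [] /eqP.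
by rewrite sqrf_eq0 subr_eq0 expectation.unlock => /eqP.
Qed.

Lemma measurable_sqr_norm n (Y : T -> 'cV[R]_n) (m : 'cV[R]_n) :
  (forall i, measurable_fun setT (component Y i)) ->
  measurable_fun setT (fun w => ((Y w - m)^T *m (Y w - m)) 0 0).
Proof.
move=> mY.
have -> : (fun w => ((Y w - m)^T *m (Y w - m)) 0 0)
    = fun w => \sum_i (component Y i w - m i 0) ^+ 2.
  by apply/funext => w; rewrite mxE; apply: eq_bigr => i _; rewrite !mxE -expr2.
apply: measurable_sum => i; apply: measurable_funX; exact: measurable_funB.
Qed.

(** Markov's inequality for the squared distance to the mean, whose expectation is the sum of the
    component variances, the trace of [S]. *)
Lemma chebyshev_sqr_norm n (Y : T -> 'cV[R]_n) mu S (r : R) :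
  has_mean_cov P Y mu S -> 0 < r ->
  (P [set w | (r <= ((Y w - mu)^T *m (Y w - mu)) 0 0)%R] <= (\tr S / r)%:E)%E.
Proof.
move=> [Y2 EY covY] r_gt0.
pose N i w := (component Y i w - mu i 0) ^+ 2.
have NE w : ((Y w - mu)^T *m (Y w - mu)) 0 0 = \sum_i N i w.
  by rewrite mxE; apply: eq_bigr => i _; rewrite !mxE -expr2.
have mN i : measurable_fun setT (EFin \o N i).
  apply/measurable_EFinP; apply: measurable_funX; apply: measurable_funB => //.
  exact: Lfun2_measurable.
have EN i : (\int[P]_w (N i w)%:E = (S i i)%:E)%E.
  by rewrite -covY covariance.unlock EY /= expectation.unlock.
have N0 i w : 0 <= N i w by exact: sqr_ge0.
under eq_set do rewrite NE.
rewrite EFinM lee_pdivlMr // muleC.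
have mW : measurable_fun setT (fun w => (\sum_i N i w)%:E).
  by apply/measurable_EFinP; apply: measurable_sum => i; apply/measurable_EFinP.
(* With the identity as the nondecreasing function, this is Markov's inequality. *)
have := @le_integral_comp_abse _ _ _ P _ measurableT _ r id
  (@measurable_id _ _ _) (fun _ => id) (fun _ _ _ _ => id) mW r_gt0.
rewrite setTI.
have -> : [set w | (r%:E <= `|(\sum_i N i w)%:E|)%E]
    = [set w | r <= \sum_i N i w].
  by apply/seteqP; split => w /=; rewrite lee_fin ger0_norm // sumr_ge0.
move=> /le_trans; apply.
under eq_integral => w _.
  rewrite gee0_abs ?lee_fin ?sumr_ge0 // -sumEFin; over.
rewrite ge0_integral_sum //; last by move=> i w _; rewrite lee_fin.
by under eq_bigr do rewrite EN; rewrite sumEFin.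
Qed.

Lemma cantelli_le (X : T -> R) (lam : R) : X \in Lfun P 2%:E -> 0 < lam ->
  (P [set w | (lam <= X w - fine 'E_P[X])%R]
    <= (fine 'V_P[X] / (fine 'V_P[X] + lam ^+ 2))%:E)%E.
Proof.
move=> X2 lam_gt0.
pose X' : {RV P >-> R} :=
  HB.pack X (isMeasurableFun.Build _ _ _ _ X (Lfun2_measurable X2)).
have := @cantelli _ _ _ P X' lam X2 lam_gt0.
rewrite (_ : [set _ | _] = [set w | lam <= X w - fine 'E_P[X]%E]) //.
have EX := fineK (expectation_fin_num (Lfun2_Lfun1 X2)).
by apply/seteqP; split => w /=; rewrite -[X in (_ - X)%E]EX -EFinB lee_fin.
Qed.

Lemma measurable_le X (c : R) : measurable_fun setT X ->
  measurable [set w | X w <= c].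
Proof.
move=> mX; rewrite -[X in measurable X]setTI.
have -> : [set w | X w <= c] = X @^-1` `]-oo, c].
  by apply/seteqP; split => w /=; rewrite in_itv.
exact: mX.
Qed.

Lemma measurable_lt X (c : R) : measurable_fun setT X ->
  measurable [set w | X w < c].
Proof.
move=> mX; rewrite -[X in measurable X]setTI.
have -> : [set w | X w < c] = X @^-1` `]-oo, c[.
  by apply/seteqP; split => w /=; rewrite in_itv.
exact: mX.
Qed.

Lemma probability_lt_ge X (c p : R) : measurable_fun setT X ->
  (P [set w | (c <= X w)%R] <= (1 - p)%:E)%E ->
  (p%:E <= P [set w | (X w < c)%R])%E.
Proof.
move=> mX.
have -> : [set w | c <= X w] = ~` [set w | X w < c].
  by apply/seteqP; split => w /=; rewrite leNgt => /negP.
have mlt := measurable_lt c mX.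
rewrite probability_setC // -(fineK (fin_num_measure P _ mlt)) -EFinB !lee_fin.
by rewrite lerD2l lerN2.
Qed.

(** * Chance constraints for a single output vector *)

Lemma chance_constraint_elementwise X (c mu p : R) :
  X \in Lfun P 2%:E -> 0 < p < 1 -> Num.sqrt (1 / (1 - p) - 1) <= mu ->
  mu * Num.sqrt (fine 'V_P[X]%E) <= c - fine 'E_P[X]%E ->
  (p%:E <= P [set w | (X w <= c)%R])%E.
Proof.
move=> X2 /andP[p_gt0 p_lt1] mu_ge tight.
have mX := Lfun2_measurable X2.
have VE : (fine 'V_P[X])%:E = 'V_P[X]%E by rewrite fineK // variance_fin_num.
have odds_gt0 : 0 < 1 / (1 - p) - 1.
  by rewrite subr_gt0 ltr_pdivlMr ?mul1r; lra.
have mu_gt0 : 0 < mu by apply: lt_le_trans mu_ge; rewrite sqrtr_gt0.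
have mu2 : 1 / (1 - p) - 1 <= mu ^+ 2.
  by rewrite -(sqr_sqrtr (ltW odds_gt0)) ler_pXn2r // nnegrE ?sqrtr_ge0 ?ltW.
have v_ge0 : 0 <= fine 'V_P[X]%E by rewrite fine_ge0 // variance_ge0.
move: v_ge0 tight; set v := fine 'V_P[X]%E => v_ge0 tight.
(* Cantelli needs a positive deviation [mu * Num.sqrt v]. If [v = 0], then [X] is almost surely its
   mean, which is at most [c]. *)
have [v_eq0|v_neq0] := eqVneq v 0.
  apply: (@le_trans _ _ (P setT)).
    by rewrite probability_setT lee_fin ltW.
  apply: le_probability_ae => //; first exact: measurable_le.
  apply: filterS (variance0_ae X2 _) => [w Xw _ /=|].
    by rewrite Xw -subr_ge0 (le_trans _ tight) // mulr_ge0 ?sqrtr_ge0 ?ltW.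
  by rewrite -VE -/v v_eq0.
have v_gt0 : 0 < v by rewrite lt_def v_neq0.
pose lam := mu * Num.sqrt v.
have lam_gt0 : 0 < lam by rewrite mulr_gt0 ?sqrtr_gt0.
have mXE : measurable_fun setT (fun w => X w - fine 'E_P[X]%E).
  exact: measurable_funB.
apply: (@le_trans _ _ (P [set w | X w - fine 'E_P[X]%E < lam])).
  apply: probability_lt_ge => //; apply: le_trans (cantelli_le X2 lam_gt0) _.
  (* The variance cancels: [v / (v + mu ^+ 2 * v) = 1 / (1 + mu ^+ 2)], which [mu2] bounds by
     [1 - p]. *)
  rewrite -/v lee_fin /lam exprMn sqr_sqrtr // ler_pdivrMr; last first.
    by rewrite addr_gt0 // mulr_gt0 // exprn_gt0.
  have : 1 / (1 - p) <= 1 + mu ^+ 2 by rewrite -lerBlDl.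
  rewrite ler_pdivrMr ?subr_gt0 //; nra.
apply: le_measure; rewrite ?inE; [exact: measurable_lt|exact: measurable_le|].
by move=> w /= lt_lam; rewrite /lam in lt_lam; lra.
Qed.

Lemma chance_constraint_polyhedron m n (Y : T -> 'cV[R]_n) ybar S
    (H : 'M[R]_(m, n)) (q : 'cV[R]_m) (mu p : R) :
  has_mean_cov P Y ybar S -> 0 < p < 1 -> Num.sqrt (n%:R / (1 - p)) <= mu ->
  (forall i, mu * Num.sqrt ((row i H *m S *m (row i H)^T) 0 0)
     <= q i 0 - (H *m ybar) i 0) ->
  (p%:E <= P [set w | polyhedron H q (Y w)])%E.
Proof.
move=> YS /andP[p_gt0 p_lt1] mu_ge tight.
have [Y2 _ _] := YS.
have mpoly : measurable [set w | polyhedron H q (Y w)].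
  have -> : [set w | polyhedron H q (Y w)]
      = \bigcap_(i in [set: 'I_m])
          [set w | component (fun w => H *m Y w) i w <= q i 0].
    by apply/seteqP; split => w /= Hw i => [_|]; exact: Hw.
  apply: fin_bigcap_measurable => // i _; apply/measurable_le/Lfun2_measurable.
  by have [] := has_mean_cov_mulmx H YS.
have [r [B [A [SE AB]]]] := psd_rank_factorization (has_mean_cov_sym YS)
  (fun x => has_mean_cov_psd x YS).
pose Z w := A *m Y w.
pose W w := ((Z w - A *m ybar)^T *m (Z w - A *m ybar)) 0 0.
have ZS : has_mean_cov P Z (A *m ybar) 1%:M.
  have -> : 1%:M = A *m S *m A^T; last exact: has_mean_cov_mulmx.
  by rewrite SE !mulmxA AB mul1mx -trmx_mul AB trmx1.
(* [(1 - BA)(Y - ybar)] has zero covariance. *)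
have span : {ae P, forall w, Y w - ybar = B *m (Z w - A *m ybar)}.
  pose C := 1%:M - B *m A.
  (* [C] annihilates the columns of [B], since [A *m B = 1]. *)
  have CS : C *m S *m C^T = 0.
    by rewrite SE !mulmxA /C mulmxBl mul1mx -(mulmxA B) AB mulmx1 subrr !mul0mx.
  have [CY2 CYE CYV] := has_mean_cov_mulmx C YS.
  have ae0 i :
      {ae P, forall w, component (fun w => C *m Y w) i w = (C *m ybar) i 0}.
    apply: filterS (variance0_ae (CY2 i) _) => [w ->|]; first by rewrite CYE.
    by rewrite /variance CYV CS mxE.
  apply: filterS (filter_forall _ ae0) => w {}ae0.
  have /eqP : C *m (Y w - ybar) = 0.
    by rewrite mulmxBr (_ : C *m Y w = C *m ybar) ?subrr //; apply/colP.
  by rewrite mulmxBl mul1mx subr_eq0 -mulmxA mulmxBr => /eqP.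
have mW : measurable_fun setT W.
  apply: measurable_sqr_norm => i; apply: Lfun2_measurable.
  by have [] := ZS.
(* In dimension 0 the hypothesis gives only [0 <= mu], while the Markov step divides by [mu ^+ 2].
   There [Y w] and [ybar] coincide. *)
have [n0|n_gt0] := posnP n.
  suff -> : [set w | polyhedron H q (Y w)] = setT.
    by rewrite probability_setT lee_fin ltW.
  apply/seteqP; split => // w _ i.
  have -> : Y w = ybar.
    by apply/colP => j; have := ltn_ord j; rewrite [X in (_ < X)%N]n0.
  rewrite -subr_ge0 (le_trans _ (tight i)) // mulr_ge0 ?sqrtr_ge0 //.
  exact: le_trans (sqrtr_ge0 _) mu_ge.
have mu_gt0 : 0 < mu.
  by apply: lt_le_trans mu_ge; rewrite sqrtr_gt0 divr_gt0 ?subr_gt0 ?ltr0n.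
have mu2 : n%:R / (1 - p) <= mu ^+ 2.
  have ratio_ge0 : 0 <= n%:R / (1 - p) by rewrite divr_ge0 // subr_ge0 ltW.
  by rewrite -(sqr_sqrtr ratio_ge0) ler_pXn2r // nnegrE ?sqrtr_ge0 ?ltW.
apply: (@le_trans _ _ (P [set w | W w < mu ^+ 2])).
  apply: probability_lt_ge => //.
  apply: le_trans (chebyshev_sqr_norm ZS _) _; first exact: exprn_gt0.
  (* The trace of the identity is [r], and a left inverse of [B] forces [r <= n]. *)
  rewrite mxtrace1 lee_fin ler_pdivrMr ?exprn_gt0 //.
  rewrite ler_pdivrMr ?subr_gt0 // in mu2.
  by rewrite mulrC (le_trans _ mu2) // ler_nat (mulmx1_min AB).
apply: le_probability_ae => //; first exact: measurable_lt.
apply: filterS span => w Yw /= Ww i.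
have -> : (H *m Y w) i 0
    = (H *m ybar) i 0 + (row i H *m B *m (Z w - A *m ybar)) 0 0.
  rewrite -mulmxA -Yw -row_mul mulmxBr.
  by move: (H *m Y w) (H *m ybar) => u v; rewrite !mxE; ring.
(* The squared norm of [row i H *m B] is the form of [S] at [row i H], because [S = B *m B^T]. *)
rewrite -lerBrDl (le_trans (dot_le_norm _ _)) // (le_trans _ (tight i)) //.
rewrite trmx_mul mulmxA -(mulmxA _ B) -SE mulrC ler_wpM2r ?sqrtr_ge0 //.
by rewrite -(ger0_norm (ltW mu_gt0)) -sqrtr_sqr ler_wsqrtr // ltW.
Qed.
End Probability.

(** * From the stacked constraint to the individual steps *)

(** Block row [k] of the identity selects step [k] of a stacked vector, and the other blocks of
    [blkdiag B] in that row vanish. *)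
Lemma submxcol_blkdiag (R : realType) L m n (B : 'I_L -> 'M[R]_(m, n)) k :
  submxcol (blkdiag B) k = B k *m submxcol 1%:M k.
Proof.
apply/mxrowP => j; rewrite -mul_submxrow -!submxblockEv mxblockK.
have -> : submxblock (1%:M : 'M[R]_(\sum_(k < L) n)) k j = (k == j)%:R%:M.
  apply/matrixP => a b; rewrite !mxE -val_eqE tagnat.eq_Rank val_eqE.
  by case: (k == j); rewrite ?mul0rn.
by case: (k == j); rewrite ?mulmx1 // raddf0 mulmx0.
Qed.

Lemma tightened_entry (R : realType) n (mu : R) (M : 'M[R]_n)
    (u v : 'cV[R]_n) i :
  vle (mu *: vsqrt (diagv M)) (u - v) ->
  mu * Num.sqrt (M i i) <= u i 0 - v i 0.
Proof. by move=> /(_ i); rewrite !mxE. Qed.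

Theorem lemma9 (R : realType) (d : measure_display) (T : measurableType d)
  (P : probability T R) (ny nc L t : nat) (p mu : R)
  (H : nat -> 'M[R]_(nc, ny)) (q : nat -> 'cV[R]_nc)
  (y : 'I_L -> T -> 'cV[R]_ny)
  (ybar : 'cV[R]_(\sum_(k < L) ny)) (Sigma : 'M[R]_(\sum_(k < L) ny))
  (p01 : 0 < p < 1)
  (moments : has_mean_cov P (fun w => \mxcol_(k < L) y k w) ybar Sigma) :
  let Hbar := blkdiag (fun k : 'I_L => H (t + k)%N) in
  let qbar := \mxcol_(k < L) q (t + k)%N in
  let tightened := vle (mu *: vsqrt (diagv (Hbar *m Sigma *m Hbar^T)))
                       (qbar - Hbar *m ybar) in
  (mu >= Num.sqrt (1 / (1 - p) - 1) -> tightened ->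
     forall (i : 'I_nc) (k : 'I_L),
       (P [set w | ((row i (H (t + k)%N) *m y k w) 0 0 <= q (t + k)%N i 0)%R]
          >= p%:E)%E)
  /\
  (mu >= Num.sqrt (ny%:R / (1 - p)) -> tightened ->
     forall k : 'I_L,
       (P [set w | polyhedron (H (t + k)%N) (q (t + k)%N) (y k w)]
          >= p%:E)%E).

Proof.
move=> Hbar qbar tightened.
pose E (k : 'I_L) : 'M[R]_(ny, \sum_(k < L) ny) := submxcol 1%:M k.
have yE k w : y k w = E k *m \mxcol_(k < L) y k w.
  by rewrite submxcol_mul mul1mx mxcolK.
have y_moments k : has_mean_cov P (y k) (E k *m ybar) (E k *m Sigma *m (E k)^T).
  by rewrite (_ : y k = fun w => E k *m \mxcol_(k < L) y k w);
    [exact: has_mean_cov_mulmx|exact/funext].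
(* Each row of the stacked constraint involves only the mean and covariance of its own step. *)
have tightE : tightened -> forall (k : 'I_L) (i : 'I_nc),
    mu * Num.sqrt ((row i (H (t + k)%N) *m (E k *m Sigma *m (E k)^T)
                    *m (row i (H (t + k)%N))^T) 0 0)
    <= q (t + k)%N i 0 - (H (t + k)%N *m (E k *m ybar)) i 0.
  move=> tight k i.
  (* [tagnat.Rank k i] is the position of row [i] of block [k] in the stacked vector. *)
  have rowE : row (tagnat.Rank k i) Hbar = row i (H (t + k)%N) *m E k.
    have := submxcol_blkdiag (fun k : 'I_L => H (t + k)%N) k.
    move/(congr1 (row i)); rewrite row_mul => <-.
    by apply/rowP => j; rewrite !mxE.
  have qbarE : qbar (tagnat.Rank k i) 0 = q (t + k)%N i 0.
    by rewrite -[in RHS](mxcolK (fun k : 'I_L => q (t + k)%N) k) [RHS]mxE.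
  have entry a b (M : 'M[R]_(a, b)) r s : M r s = row r M 0 s by rewrite mxE.
  have HbarE : (Hbar *m ybar) (tagnat.Rank k i) 0
      = (H (t + k)%N *m (E k *m ybar)) i 0.
    by rewrite entry row_mul rowE -mulmxA -row_mul -entry.
  have diagE : (Hbar *m Sigma *m Hbar^T) (tagnat.Rank k i) (tagnat.Rank k i)
      = (row i (H (t + k)%N) *m (E k *m Sigma *m (E k)^T)
           *m (row i (H (t + k)%N))^T) 0 0.
    transitivity ((row (tagnat.Rank k i) Hbar *m Sigma
                     *m (row (tagnat.Rank k i) Hbar)^T) 0 0).
      rewrite entry !row_mul; move: (_ *m Sigma) => u.
      by rewrite !mxE; apply: eq_bigr => j _; rewrite !mxE.
    by rewrite rowE trmx_mul !mulmxA.
  by rewrite -diagE -HbarE -qbarE; exact: tightened_entry.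
split=> mu_ge tight k.
  (* In this branch [k] is the constraint row and [j] the time step; the scalar is the single
     component of a vector of size 1. *)
  move=> j; have [L2 EX VX] :=
    has_mean_cov_mulmx (row k (H (t + j)%N)) (y_moments j).
  apply: (chance_constraint_elementwise (L2 0) p01 mu_ge).
  rewrite /variance VX EX /=.
  have -> : (row k (H (t + j)%N) *m (E j *m ybar)) 0 0
      = (H (t + j)%N *m (E j *m ybar)) k 0 by rewrite -row_mul mxE.
  exact: tightE.
apply: chance_constraint_polyhedron (y_moments k) p01 mu_ge _ => i.
exact: tightE.
Qed.
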